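(* Let $f$ be an admissible polynomial, let $a,k\in\mathbb{Z}_+$ and let $\delta\in\mathbb{Z}_+$ with $\delta\mid\Pi_f$. Then $p_f(a,\delta k;n)=0$ for every integer $n\ge 0$ with $\delta\nmid (n-af(0))$, and for every $q=e^{-z}$ with $z\in\mathbb{C}$, $\Re(z)>0$, $$\sum_{\substack{n\ge 0\\ n\equiv af(0)\ (\mathrm{mod}\ \delta)}}\left(p_f(a,\delta k;n)-\frac{p_f(n)}{k}\right)q^n=\frac{1}{k\delta}\sum_{\substack{1\le j<k\\ 0\le \ell<\delta}}\zeta_{\delta k}^{-ja-k\ell af(0)}\,G_f\!\left(\zeta_{\delta k}^{j},\ \zeta_{\delta}^{\ell}q\right).$$ In particular, $p_f(a,\delta;n)=p_f(n)$ whenever $\delta\mid (n-af(0))$.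
   Context: Admissible polynomial: $f(x)\in\mathbb{Q}[x]$ is a nonconstant polynomial that is integer-valued (i.e. $f(\mathbb{Z})\subseteq\mathbb{Z}$), satisfies $f(\ell)>0$ for all integers $\ell\ge 1$, and is such that for every prime $p$ there exists an integer $\ell$ with $p\nmid f(\ell)$. $\Pi_f$ is the product over primes $p$ of $p^{s}$, where $p^s$ is the largest power of $p$ dividing $f(\ell)-f(0)$ for all $\ell\in\mathbb{Z}$; equivalently $\Pi_f=\gcd\{f(\ell)-f(0):\ell\in\mathbb{Z}\}$. $p_f(n)$ is the number of partitions of $n$ whose parts are taken from the sequence $\{f(\ell)\}_{\ell=1}^\infty$, and $p_f(m,n)$ is the number of those with exactly $m$ parts (if a value occurs several times in the sequence, its occurrences count as distinct kinds of part), so that $$\sum_{n\ge 0}p_f(n)q^n=\prod_{n\ge1}\frac{1}{1-q^{f(n)}},\qquad G_f(\zeta,q):=\sum_{m,n\ge 0}p_f(m,n)\zeta^mq^n=\prod_{n\ge1}\frac{1}{1-\zeta q^{f(n)}}$$ for complex $q$ with $|q|<1$ and complex $\zeta$ with $|\zeta|<1/|q|$. For $k\in\mathbb{Z}_+$ and $a\in\mathbb{Z}$, $p_f(a,k;n):=\sum_{m\ge 0,\ m\equiv a\ (\mathrm{mod}\ k)}p_f(m,n)$, the number of such partitions of $n$ whose number of parts is congruent to $a$ modulo $k$. $\zeta_a^b:=e^{2\pi i b/a}$. *)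

(* Defs.v *)
From mathcomp Require Import all_boot all_order all_algebra.
From mathcomp Require Import complex finmap.
From mathcomp Require Import all_classical all_reals all_analysis.
From mathcomp Require Import showcase.summability.

Set Implicit Arguments.
Unset Strict Implicit.
Unset Printing Implicit Defensive.

Import Order.TTheory GRing.Theory Num.Theory.
Import numFieldNormedType.Exports.

Local Open Scope classical_set_scope.
Local Open Scope ring_scope.

(* The numerator of f(l): for an integer-valued f this is f(l) itself. *)
Definition polyZ (f : {poly rat}) (l : int) : int := numq f.[l%:~R].

Definition admissible (f : {poly rat}) : Prop :=
  [/\ (1 < size f)%N,
      forall l : int, f.[l%:~R] \is a Num.int,
      forall l : int, 1 <= l -> 0 < f.[l%:~R]
    & forall p : nat, prime p -> exists l : int, ~~ (p%:Z %| polyZ f l)%Z].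

Definition dvd_diffs (f : {poly rat}) (d : nat) : Prop :=
  forall l : int, (d%:Z %| polyZ f l - polyZ f 0)%Z.

(* The largest s such that p ^ s divides f(l) - f(0) for all l; it exists when
   p is prime and f is nonconstant and integer-valued. *)
Definition Pi_exponent (f : {poly rat}) (p : nat) : nat :=
  xget 0%N [set s | dvd_diffs f (p ^ s) /\
                    forall t : nat, dvd_diffs f (p ^ t) -> (t <= s)%N].

(* A product with finite support: the exponent is 0 for all but finitely many
   primes. *)
Definition Pi (f : {poly rat}) : nat :=
  \big[muln/1%N]_(p \in [set p : nat | prime p]) (p ^ Pi_exponent f p)%N.

(* A partition of n with parts in the sequence f(1), f(2), ... is encoded by the
   nondecreasing list of the indices of its parts, so that equal values
   occurring at different indices are distinct kinds of part. *)
Definition partitions (f : {poly rat}) (n : nat) : set (seq nat) :=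
  [set s | [/\ sorted leq s, all (leq 1) s
             & \sum_(l <- s) polyZ f l%:Z = n%:Z]].

(* [fset_set] is junk on infinite sets, but these sets are finite for an
   admissible f. *)
Definition pf (f : {poly rat}) (n : nat) : nat :=
  #|` fset_set (partitions f n)|.

Definition pf_parts (f : {poly rat}) (m n : nat) : nat :=
  #|` fset_set (partitions f n `&` [set s | size s = m])|.

(* A sum with finite support: for an admissible f all parts are at least 1, so
   that pf_parts f m n = 0 for m > n. *)
Definition pf_mod (f : {poly rat}) (a : int) (k n : nat) : nat :=
  \big[addn/0%N]_(m \in [set m : nat | (m%:Z = a %[mod k%:Z])%Z])
    pf_parts f m n.

(* Declared as a numClosedFieldType in order to get the topology that
   numFieldNormedType provides. *)
Definition Cpx (R : realType) : numClosedFieldType := R[i].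

Definition cexp (R : realType) (z : Cpx R) : Cpx R :=
  (expR (complex.Re z))%:C%C *
  ((cos (complex.Im z)) +i* (sin (complex.Im z)))%C.

Definition zeta (R : realType) (a : nat) (b : int) : Cpx R :=
  cexp (2 * (pi : R)%:C%C * 'i * b%:~R / a%:R : Cpx R).

(* The unordered sum over N x N. *)
Definition Gf (R : realType) (f : {poly rat}) (x q : Cpx R) : Cpx R :=
  sum (fun mn : nat * nat =>
    ((pf_parts f mn.1 mn.2)%:R * x ^+ mn.1 * q ^+ mn.2 : Cpx R)).

(* Main.v *)
(* If a partition of n into m parts exists, then n = m f(0) mod d, because d
   divides every f(l) - f(0); and f(0) is prime to d, because f has no fixed
   prime divisor. So for n = a f(0) mod d every number of parts is congruent to
   a mod d. The sum over the d-th roots of unity selects these n, and the sum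
   over j, completed by the term j = 0, which accounts for p_f(n) / k, then
   selects the m congruent to a mod dk. For convergence, the partitions with
   parts of index at most L have total weight at most the product of the
   1 / (1 - r ^ f(l)), which is bounded since f takes each value boundedly often. *)
Require Import Defs.
From mathcomp Require Import all_boot all_order all_algebra.
From mathcomp Require Import complex finmap.
From mathcomp Require Import all_classical all_reals all_analysis.
From mathcomp Require Import showcase.summability.
From mathcomp Require Import zify ring lra.

Import Order.TTheory GRing.Theory Num.Theory.
Import numFieldNormedType.Exports.

Local Open Scope classical_set_scope.
Local Open Scope ring_scope.

(** * Enumeration of nondecreasing index lists *)

(** Nondecreasing lists with entries in 1..L and length at most M, each once: either L does not
    occur, or a last entry L is split off. The second case keeps L and lowers M, hence the nested
    [fix]. *)
Fixpoint bounded_lists (L M : nat) {struct L} : seq (seq nat) :=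
  if L is L'.+1 then
    (fix aux M := bounded_lists L' M ++
       if M is M'.+1 then [seq rcons s L | s <- aux M'] else [::]) M
  else [:: [::]].

Lemma bounded_lists0 M : bounded_lists 0 M = [:: [::]].
Proof. by []. Qed.

Lemma bounded_listsS0 L : bounded_lists L.+1 0 = bounded_lists L 0.
Proof. by rewrite /= cats0. Qed.

Lemma bounded_listsSS L M : bounded_lists L.+1 M.+1 =
  bounded_lists L M.+1 ++ [seq rcons s L.+1 | s <- bounded_lists L.+1 M].
Proof. by []. Qed.

Lemma sorted_rcons_leq s x : sorted leq (rcons s x) =
  sorted leq s && all (fun y => (y <= x)%N) s.
Proof.
rewrite !(sorted_pairwise (leT := leq)); try by move=> ? ? ?; apply: leq_trans.
by rewrite pairwise_rcons andbC.
Qed.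

Lemma mem_bounded_lists L M s : (s \in bounded_lists L M) =
  [&& sorted leq s, all (fun l => (1 <= l <= L)%N) s & (size s <= M)%N].
Proof.
elim: L M s => [M s|L IHL M].
  rewrite bounded_lists0 inE; case: s => [|x s] //=.
  by rewrite (_ : (0 < x <= 0)%N = false) ?andbF//; lia.
elim: M => [|M IHM] s.
  by rewrite bounded_listsS0 IHL; case: s => //= x s; rewrite !andbF.
rewrite bounded_listsSS mem_cat IHL.
apply/idP/idP.
  case/orP=> [/and3P[-> al ->]|].
    by rewrite andbT/=; apply: sub_all al => x; lia.
  case/mapP=> t; rewrite IHM => /and3P[st al sz] ->.
  rewrite sorted_rcons_leq st all_rcons size_rcons (ltnS (size t)) sz leqnn !andbT/=.
  apply/andP; split => //.
  by apply: sub_all al => x /andP[].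
case/lastP: s => [//|s x]; rewrite sorted_rcons_leq all_rcons size_rcons ltnS.
case/and3P=> /andP[ss slex] /andP[xL al] sz.
have [xltL|] := leqP x L.
  apply/orP; left; rewrite ss slex sz/= andbT all_rcons.
  apply/andP; split; first by lia.
  by apply/allP => y ys; move: (allP slex _ ys) (allP al _ ys); lia.
move=> Lx; have -> : x = L.+1 by lia.
apply/orP; right; apply/mapP; exists s => //.
by rewrite IHM ss al.
Qed.

Lemma bounded_lists_uniq L M : uniq (bounded_lists L M).
Proof.
elim: L M => [//|L IHL]; elim=> [|M IHM]; first by rewrite bounded_listsS0.
rewrite bounded_listsSS cat_uniq IHL map_inj_uniq; last exact: rcons_injl.
rewrite IHM andbT/=; apply/hasPn => _ /mapP[s _ ->].
by rewrite mem_bounded_lists all_rcons ltnn !andbF.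
Qed.

(** * Weights of lists and bounds for sums of powers *)

Definition weight (F : nat -> nat) (s : seq nat) : nat := (\sum_(l <- s) F l)%N.

Lemma size_le_weight {F s} : (forall l, (0 < l)%N -> (0 < F l)%N) ->
  all (leq 1) s -> (size s <= weight F s)%N.
Proof.
move=> Fpos; elim: s => [//|x s IHs] /= /andP[x1 s1].
by rewrite /weight big_cons -add1n leq_add ?Fpos// IHs.
Qed.

Lemma mem_le_weight F s l : l \in s -> (F l <= weight F s)%N.
Proof.
elim: s => [//|x s IHs]; rewrite inE /weight big_cons => /orP[/eqP->|/IHs].
  exact: leq_addr.
by move/leq_trans; apply; rewrite leq_addl.
Qed.

(** Each value is taken at no more than D positive indices; duplicate-free lists stand for the
    finite subsets of a fiber. *)
Definition fibers_le (F : nat -> nat) (D : nat) : Prop :=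
  forall v s, uniq s -> all (leq 1) s -> all (fun l => F l == v) s ->
  (size s <= D)%N.

(** Each single value is avoided from some index on, so the values 0, ..., n can be excluded one
    after another. *)
Lemma fibers_le_unbounded {F D} : fibers_le F D ->
  forall n, exists L, forall l, (L < l)%N -> (n < F l)%N.
Proof.
move=> FD; have avoid v : exists L, forall l, (L < l)%N -> F l != v.
  apply: contrapT => /forallNP nL.
  have [s [us s1 sv ss]] : exists s, [/\ uniq s, all (leq 1) s,
      all (fun l => F l == v) s & size s = D.+1].
    elim: D.+1 => [|m [s [us s1 sv ss]]]; first by exists [::].
    (* An index beyond the maximum of the list is new, so the fiber grows to D + 1 elements. *)
    have /existsNP[l /not_implyP[sl /negP]] := nL (\max_(i <- s) i)%N.
    rewrite negbK => Fl; exists (l :: s); rewrite /= us s1 sv Fl ss !andbT.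
    split => //; last by lia.
    apply/negP => ls; move: sl; rewrite ltnNge => /negP; apply.
    exact: leq_bigmax_seq.
  by have := FD v s us s1 sv; rewrite ss ltnn.
elim=> [|n [L HL]].
  by have [L HL] := avoid 0%N; exists L => l /HL; lia.
have [L' HL'] := avoid n.+1; exists (maxn L L') => l.
by rewrite gtn_max => /andP[/HL + /HL']; lia.
Qed.

(** Grouping the indices by their value bounds the sum by D times a geometric series, uniformly in
    K. *)
Lemma sum_fibers_le (R : numDomainType) F D (r : R) K : 0 <= r -> r < 1 ->
  fibers_le F D ->
  (\sum_(1 <= l < K.+1) r ^+ F l) * (1 - r) <= D%:R.
Proof.
move=> r0 r1 FD; pose V := (\max_(1 <= l < K.+1) F l).+1.
have -> : \sum_(1 <= l < K.+1) r ^+ F l =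
    \sum_(v < V) (count (fun l => F l == v) (index_iota 1 K.+1))%:R * r ^+ v.
  under [RHS]eq_bigr => v _ do rewrite -sum1_count natr_sum mulr_suml.
  rewrite (exchange_big_dep xpredT)//= big_seq [RHS]big_seq; apply: eq_bigr => l lK.
  have FV : (F l < V)%N by rewrite ltnS; apply: leq_bigmax_seq.
  rewrite (bigD1 (Ordinal FV))//= mul1r big1 ?addr0// => i /andP[/eqP Fi].
  by case/eqP; apply: val_inj.
apply: (@le_trans _ _ ((\sum_(v < V) D%:R * r ^+ v) * (1 - r))).
  apply: ler_wpM2r; first by rewrite subr_ge0 ltW.
  apply: ler_sum => v _; apply: ler_wpM2r; first exact: exprn_ge0.
  rewrite ler_nat -size_filter; apply: (FD v).
  - exact/filter_uniq/iota_uniq.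
  - by apply/allP => l; rewrite mem_filter mem_index_iota => /and3P[].
  - exact: filter_all.
rewrite -mulr_sumr -mulrA -[leRHS]mulr1 ler_wpM2l// ?ler0n//.
by rewrite mulrC -opprB mulNr -subrX1 opprB gerBl exprn_ge0.
Qed.

(* By the recurrence h(L+1, M+1) = h(L, M+1) + x_(L+1) h(L+1, M) of the complete
   homogeneous symmetric sums, where x_l = r ^ F l. *)
Lemma sum_bounded_lists_le {R : numDomainType} {F : nat -> nat} {r : R} L M :
  0 <= r -> r < 1 ->
  (\sum_(s <- bounded_lists L M) r ^+ weight F s) *
    \prod_(1 <= l < L.+1) (1 - r ^+ F l) <= 1.
Proof.
move=> r0 r1; elim: L M => [M|L IHL M].
  by rewrite bounded_lists0 big_seq1 big_geq// mulr1 /weight big_nil.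
have P0 : 0 <= 1 - r ^+ F L.+1 by rewrite subr_ge0 exprn_ile1// ltW.
elim: M => [|M IHM].
  rewrite bounded_listsS0 big_nat_recr//= mulrA.
  by rewrite (le_trans (ler_wpM2r P0 (IHL 0%N)))// mul1r gerBl exprn_ge0.
rewrite bounded_listsSS big_cat big_map/=.
under [X in _ + X]eq_bigr => s _ do rewrite /weight -cats1 big_cat big_seq1 exprD.
rewrite -mulr_suml mulrDl big_nat_recr//= mulrA mulrAC -mulrA.
(* The bound 1 is split as (1 - x) + x with x = r ^ F(L+1): [IHL] bounds the first summand, [IHM]
   the second. *)
rewrite [X in _ + X * (_ * _)]mulrC -[X in _ + X]mulrA -[1 in leRHS](subrK (r ^+ F L.+1)).
rewrite lerD//.
  by rewrite mulrA mulrAC -[leRHS]mul1r ler_wpM2r.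
rewrite -[leRHS]mulr1 ler_wpM2l ?exprn_ge0//.
by move: IHM; rewrite big_nat_recr.
Qed.

(** * Partition counts of an admissible polynomial *)

Definition part_size (f : {poly rat}) (l : nat) : nat := `|polyZ f l|%N.

Section Admissible.
Context {f : {poly rat}} (hf : admissible f).

Lemma polyZ_rat l : (polyZ f l)%:~R = f.[l%:~R].
Proof. by case: hf => _ /(_ l) + _ _ => /numqK. Qed.

Lemma polyZ_gt0 (l : nat) : (0 < l)%N -> 0 < polyZ f l.
Proof.
by case: hf => _ _ fpos _ l0; rewrite -(ltr0z rat) polyZ_rat; apply: fpos.
Qed.

Lemma polyZE (l : nat) : (0 < l)%N -> polyZ f l = part_size f l.
Proof. by move=> l0; rewrite /part_size gez0_abs// ltW// polyZ_gt0. Qed.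

Lemma part_size_gt0 l : (0 < l)%N -> (0 < part_size f l)%N.
Proof. by move=> l0; rewrite absz_gt0 gt_eqF// polyZ_gt0. Qed.

(** The indices in a fiber are distinct roots of f - v, which is nonzero because f is
    nonconstant. *)
Lemma part_size_fibers_le : fibers_le (part_size f) (size f).
Proof.
case: (hf) => f1 _ _ _ v s us s1 sv.
pose g := f - v%:R%:P; have g0 : g != 0.
  by apply: contraTneq f1 => /subr0_eq ->; rewrite size_polyC; case: (_ == _).
have szg : (size g <= size f)%N.
  rewrite (leq_trans (size_polyD _ _))// geq_max leqnn size_polyN size_polyC.
  by case: (_ == _) => //=; rewrite (ltnW f1).
apply: leq_trans szg; apply: ltnW.
rewrite -(size_map (fun l : nat => l%:R : rat)); apply: max_poly_roots => //.
  apply/allP => _ /mapP[l ls ->]; rewrite rootE !hornerE subr_eq0.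
  rewrite -[l%:R]/(l%:~R) -polyZ_rat polyZE ?(allP s1)//.
  by rewrite (eqP (allP sv _ ls)).
by rewrite map_inj_uniq// => i j /eqP; rewrite eqr_nat => /eqP.
Qed.

Lemma mem_partitions n s : partitions f n s <->
  [/\ sorted leq s, all (leq 1) s & weight (part_size f) s = n].
Proof.
have sumE : all (leq 1) s -> \sum_(l <- s) polyZ f l = (weight (part_size f) s)%:Z.
  move=> s1; rewrite /weight (big_morph Posz PoszD (erefl _)).
  by rewrite !big_seq; apply: eq_bigr => l ls; rewrite polyZE// (allP s1).
split=> -[ss s1]; first by rewrite sumE// => -[].
by move=> wn; split; rewrite ?sumE ?wn.
Qed.

(** Beyond some L all parts exceed N, and a partition of n has at most n parts because parts are
    positive. So the sets of partitions are finite, and one list serves all n up to N. *)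
Lemma pf_count N : exists L, forall n, (n <= N)%N ->
  pf f n = count (fun s => weight (part_size f) s == n) (bounded_lists L N) /\
  forall m, pf_parts f m n =
    count (fun s => (size s == m) && (weight (part_size f) s == n)) (bounded_lists L N).
Proof.
have [L HL] := fibers_le_unbounded part_size_fibers_le N.
(* The predicate P covers both counts: it is constantly true for [pf] and fixes the length for
   [pf_parts]. *)
exists L => n nN; have card_count (P : pred (seq nat)) :
    #|` fset_set (partitions f n `&` [set s | P s])| =
    count (fun s => P s && (weight (part_size f) s == n)) (bounded_lists L N).
  set Q : pred (seq nat) := fun s => _.
  pose A := [fset s in [seq s <- bounded_lists L N | Q s]]%fset.
  have -> : partitions f n `&` [set s | P s] = [set` A].
    apply/seteqP; split=> s /=; rewrite inE mem_filter.
      move=> [/mem_partitions[ss s1 ws] Ps].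
      rewrite /Q Ps ws eqxx mem_bounded_lists ss/=.
      rewrite (leq_trans _ nN) -?ws ?(size_le_weight part_size_gt0)// andbT.
      apply/allP => l ls; rewrite (allP s1)//= leqNgt; apply/negP => /HL.
      by rewrite ltnNge (leq_trans _ nN)// -ws mem_le_weight.
    rewrite /Q mem_bounded_lists => /andP[/andP[Ps /eqP ws]].
    case/and3P => ss s1 _; split=> //; apply/mem_partitions; split=> //.
    by apply: sub_all s1 => l /andP[].
  rewrite set_fsetK card_fseq undup_id ?size_filter//.
  exact/filter_uniq/bounded_lists_uniq.
split=> [|m].
  have <- := card_count xpredT; rewrite (_ : [set _ | _] = setT) ?setIT//.
  by apply/seteqP; split.
rewrite -(card_count (fun s => size s == m)); congr (#|` fset_set (_ `&` _)|).
by apply/seteqP; split=> s /eqP.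
Qed.

Lemma pf_parts_partition m n : pf_parts f m n != 0%N ->
  exists2 s, partitions f n s & size s = m.
Proof.
have [L /(_ n (leqnn n))[_ ->]] := pf_count n.
rewrite -lt0n -has_count => /hasP[s]; rewrite mem_bounded_lists.
case/and3P=> ss s1 _ /andP[/eqP sm /eqP ws]; exists s => //.
apply/mem_partitions; split=> //.
by apply: sub_all s1 => l /andP[].
Qed.

Lemma pf_parts_eq0 m n : (n < m)%N -> pf_parts f m n = 0%N.
Proof.
move=> nm; apply: contraTeq nm => /pf_parts_partition[s /mem_partitions[_ s1 <-] <-].
by rewrite -leqNgt size_le_weight//; apply: part_size_gt0.
Qed.

Lemma pf_sum K n : (n < K)%N -> pf f n = (\sum_(0 <= m < K) pf_parts f m n)%N.
Proof.
move=> nK; have [L /(_ n (leqnn n))[-> pfE]] := pf_count n.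
under eq_bigr => m _ do rewrite pfE -sum1_count big_mkcond.
rewrite -sum1_count big_mkcond/= exchange_big/= big_seq [RHS]big_seq.
apply: eq_bigr => s; rewrite mem_bounded_lists => /and3P[_ s1 sn].
rewrite big_mkord (bigD1 (Ordinal (leq_ltn_trans sn nK)))//= eqxx.
by rewrite big1 ?addn0// => i /eqP; case: eqP => //= si []; apply/val_inj.
Qed.

(** All m >= K > n contribute 0, so the finitely supported sum may be cut off at K. *)
Lemma pf_mod_sum a k K n : (n < K)%N -> pf_mod f a k n =
  (\sum_(0 <= m < K | (m%:Z == a %[mod k%:Z])%Z) pf_parts f m n)%N.
Proof.
move=> nK; rewrite /pf_mod; set P := fun m : nat => (m%:Z == a %[mod k%:Z])%Z.
rewrite (_ : [set m : nat | _] = [set` P]); last first.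
  by apply/seteqP; split=> m /eqP.
rewrite -(@bigfs _ _ _ _ (index_iota 0 K)) ?iota_uniq// => m _.
by rewrite mem_index_iota -leqNgt => Km; rewrite pf_parts_eq0// (leq_trans nK).
Qed.

(** * Congruences modulo a divisor of Pi *)

(** The factors of Pi are powers of distinct primes, hence pairwise coprime, and each divides f(l) -
    f(0); so does their product. *)
Lemma dvd_diffs_Pi {d} : (d %| Pi f)%N -> dvd_diffs f d.
Proof.
move=> dPi l; apply: (@dvdz_trans (Pi f)) => //; rewrite /Pi dvdzE absz_nat.
set D := (`|_|%N); set r := finite_support _ _ _.
(* For an infinite support the list r is empty and the claim is vacuous. *)
have rp p : p \in r -> prime p.
  have [fin|] := pselect (finite_set ([set p : nat | prime p] `&`
      (fun p => p ^ Pi_exponent f p)%N @^-1` [set~ 1%N])).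
    by rewrite /r in_finite_support// inE => -[].
  by move=> inf; rewrite /r no_finite_support.
(* If there is no largest exponent, the default value 0 gives the factor 1. *)
have rD p : (p ^ Pi_exponent f p %| D)%N.
  rewrite /Pi_exponent; case: xgetP => [s -> [sD _]|_]; last exact: dvd1n.
  exact: sD.
have ur : uniq r := finite_support_uniq _ _ _.
elim: r ur rp => [|p r IHr]; first by rewrite big_nil dvd1n.
move=> /= /andP[pr ur] rp; rewrite big_cons Gauss_dvd ?rD/=.
  by apply: IHr => // q qr; apply: rp; rewrite inE qr orbT.
have pp : prime p by apply: rp; rewrite inE eqxx.
rewrite big_seq; elim/big_rec : _ => [|q m qr]; first exact: coprimen1.
rewrite coprimeMr => ->; rewrite andbT coprimeXl// coprimeXr//.
rewrite prime_coprime// dvdn_prime2//; last by rewrite rp// inE qr orbT.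
by apply: contraNneq pr => ->.
Qed.

Section Divisor.
Context {d : nat} (hd : (d %| Pi f)%N).

(** Each of the m parts is congruent to f(0) modulo d. *)
Lemma partition_mod {m n} : pf_parts f m n != 0%N ->
  (n%:Z == m%:Z * polyZ f 0 %[mod d%:Z])%Z.
Proof.
case/pf_parts_partition => s [_ _ <-] <-.
rewrite eqz_mod_dvd; elim: s => [|l s IHs].
  by rewrite big_nil mul0r subrr dvdz0.
rewrite big_cons/= -add1n PoszD mulrDl mul1r opprD addrACA.
by rewrite rpredD//; apply: dvd_diffs_Pi.
Qed.

(** A common prime factor of d and f(0) would divide every f(l), against admissibility. *)
Lemma coprimez_polyZ0 : (0 < d)%N -> coprimez d (polyZ f 0).
Proof.
move=> d0; rewrite coprimezE absz_nat /coprime; apply/negPn/negP => g1.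
have pp := pdiv_prime (n := gcdn d `|polyZ f 0|).
have /pp {}pp : (1 < gcdn d `|polyZ f 0|)%N.
  by rewrite ltn_neqAle eq_sym g1 gcdn_gt0 d0.
case: (hf) => _ _ _ /(_ _ pp)[l /negP]; apply.
rewrite -(subrK (polyZ f 0) (polyZ f l)) rpredD//.
  apply: dvdz_trans (dvd_diffs_Pi hd l).
  by rewrite dvdzE (dvdn_trans (pdiv_dvd _) (dvdn_gcdl _ _)).
by rewrite dvdzE (dvdn_trans (pdiv_dvd _) (dvdn_gcdr _ _)).
Qed.
End Divisor.
End Admissible.

(* The instance in summability.v is local to its section. *)
Local Existing Instance totally_filter.

(** * Unordered sums of complex numbers *)

Lemma normCE {R : realType} (z : Cpx R) : `|z| = (complex.Re `|z|)%:C%C.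
Proof. by rewrite RRe_real// normr_real. Qed.

Lemma normc_le_ReIm {R : realType} (z : Cpx R) :
  `|z| <= (`|complex.Re z| + `|complex.Im z|)%:C%C.
Proof.
have normR (y : R) : `|y%:C%C : Cpx R| = `|y|%:C%C.
  by rewrite normc_def/= expr0n addr0 sqrtr_sqr.
rewrite {1}[z]complexE (le_trans (ler_normD _ _))// normrM !normR.
by rewrite (normc_def 'i%C)/= expr0n add0r expr1n sqrtr1 mul1r rmorphD.
Qed.

Lemma cvg_complex {R : realType} {T : Type} {F : set_system T} {FF : Filter F}
    (u : T -> Cpx R) (a b : R) :
  (@complex.Re R \o u) @ F --> a -> (@complex.Im R \o u) @ F --> b ->
  u @ F --> (a +i* b : Cpx R)%C.
Proof.
move=> /cvgrPdist_lt ua /cvgrPdist_lt ub; apply/cvgrPdist_lt => -[e e'].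
rewrite ltcE/= => /andP[/eqP-> e0].
have e20 : 0 < e / 2 by rewrite divr_gt0.
near=> t; apply: le_lt_trans (normc_le_ReIm _) _.
rewrite ltcR [ltRHS]splitr ltrD//.
  have : `|a - complex.Re (u t)| < e / 2 by near: t; exact: ua.
  by case: (u t).
have : `|b - complex.Im (u t)| < e / 2 by near: t; exact: ub.
by case: (u t).
Unshelve. all: by end_near.
Qed.

Lemma partial_sum_fset {I : choiceType} {V : zmodType} (x : I -> V) (J : {fset I}) :
  partial_sum x J = \sum_(i <- J) x i.
Proof. by rewrite big_seq_fsetE. Qed.

(** Partial sums of nonnegative terms grow with the finite set, so they converge to their
    supremum. *)
Lemma is_cvg_partial_sum_ge0 {R : realType} {I : choiceType} {u : I -> R} {M : R} :
  (forall i, 0 <= u i) ->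
  (forall J : {fset I}, \sum_(i <- J) u i <= M) ->
  exists l : R, partial_sum u @ totally --> l.
Proof.
move=> u0 uM; pose S := range (partial_sum u).
have hS : has_sup S.
  split; first by exists (partial_sum u fset0), fset0.
  by exists M => _ [J _ <-]; rewrite partial_sum_fset.
exists (sup S); apply/cvgrPdist_lt => e e0.
have [_ [A _ <-] lA] := sup_adherent e0 hS.
exists A => // B /= AB.
have uAB : partial_sum u A <= partial_sum u B.
  rewrite !partial_sum_fset [leRHS](bigID (mem A))/= -[X in _ <= X + _]big_filter.
  rewrite [X in _ <= X + _](perm_big A) ?lerDl ?sumr_ge0//.
  apply: uniq_perm; rewrite ?filter_uniq// => i; rewrite mem_filter /= andb_idr//.
  exact/fsubsetP.
have uB : partial_sum u B <= sup S by apply: sup_upper_bound => //; exists B.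
by rewrite ger0_norm ?subr_ge0// ltrBlDl -ltrBlDr (lt_le_trans lA).
Qed.

(* The real and imaginary parts are differences of nonnegative summable
   families, so that no completeness of the complex numbers is needed. *)
Lemma cvg_partial_sum_complex {R : realType} {I : choiceType}
    {g : I -> Cpx R} {M : R} :
  (forall J : {fset I}, \sum_(i <- J) complex.Re `|g i| <= M) ->
  partial_sum g @ totally --> sum g.
Proof.
move=> gM.
suff [l gl] : exists l : Cpx R, partial_sum g @ totally --> l.
  by rewrite /sum (cvg_lim (@norm_hausdorff _ _) gl).
pose w i := complex.Re `|g i|.
have wE i : `|g i| = (w i)%:C%C := normCE _.
have w0 i : 0 <= w i by rewrite -ler0c -wE.
(* Here h is the real or the imaginary part: h(g) + |g| is nonnegative with sums at most 2M, and
   subtracting the convergent sum of |g| leaves that of h(g). *)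
have part_cvg (h : Cpx R -> R) : {morph h : x y / x + y} -> h 0 = 0 ->
    (forall z, `|h z| <= complex.Re `|z|) ->
    exists l : R, h \o partial_sum g @ totally --> l.
  move=> hD h0 hn.
  have [lw wl] := is_cvg_partial_sum_ge0 w0 gM.
  have hw i : 0 <= h (g i) + w i.
    by rewrite -[h _]opprK addrC subr_ge0 (le_trans _ (hn _))// -normrN ler_norm.
  have [|lh hl] := @is_cvg_partial_sum_ge0 R I (fun i => h (g i) + w i) (M + M) hw.
    move=> J; rewrite big_split lerD//= (le_trans _ (gM J))// ler_sum// => i _.
    exact: le_trans (ler_norm _) (hn _).
  exists (lh - lw); have -> : h \o partial_sum g =
      partial_sum (fun i => h (g i) + w i) \- partial_sum w.
    apply/funext => J /=; rewrite !partial_sum_fset big_split/= addrK.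
    exact: big_morph.
  exact: cvgB.
have [||z|a ga] := part_cvg (@complex.Re R).
- by move=> [? ?] [? ?].
- by [].
- by rewrite -lecR -normCE normc_ge_Re.
have [||z|b gb] := part_cvg (@complex.Im R).
- by move=> [? ?] [? ?].
- by [].
- rewrite -lecR -normCE -normrN -ReiNIm (le_trans (normc_ge_Re _))// normrM.
  by rewrite (normc_def 'i%C)/= expr0n add0r expr1n sqrtr1 mulr1.
by exists (a +i* b)%C; apply: cvg_complex.
Qed.

(** Every finite set of pairs lies in all sufficiently large squares, so the square sums follow the
    unordered sum. *)
Lemma cvg_sum_boxes {R : realType} {g : nat * nat -> Cpx R} {M : R} :
  (forall J : {fset nat * nat}, \sum_(i <- J) complex.Re `|g i| <= M) ->
  (fun N => \sum_(0 <= n < N) \sum_(0 <= m < N) g (m, n)) @ \oo --> sum g.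
Proof.
move=> /cvg_partial_sum_complex gs.
pose box N := [fset mn in [seq (m, n) | n <- index_iota 0 N, m <- index_iota 0 N]]%fset.
have -> : (fun N => \sum_(0 <= n < N) \sum_(0 <= m < N) g (m, n)) =
    partial_sum g \o box.
  apply/funext => N /=; rewrite partial_sum_fset.
  rewrite (perm_big [seq (m, n) | n <- index_iota 0 N, m <- index_iota 0 N]).
    by rewrite big_allpairs_dep.
  apply: uniq_perm; rewrite ?fset_uniq//; last by move=> mn; rewrite inE.
  by apply: allpairs_uniq; rewrite ?iota_uniq// => -[n m] [n' m'] _ _ [-> ->].
apply: cvg_comp gs => A [J _ JA].
exists (\max_(mn <- J) maxn mn.1 mn.2).+1 => // N /= JN; apply: JA => /=.
apply/fsubsetP => -[m n] mnJ; rewrite inE; apply/allpairsP; exists (n, m).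
have : (maxn m n < N)%N.
  apply: leq_trans JN; rewrite ltnS.
  exact: (@leq_bigmax_seq _ _ xpredT (fun mn => maxn mn.1 mn.2) (m, n)).
by rewrite gtn_max !mem_index_iota => /andP[-> ->].
Qed.

(** * The exponential and roots of unity *)

Lemma cexpD {R : realType} (x y : Cpx R) : cexp (x + y) = cexp x * cexp y.
Proof.
case: x y => [a b] [c e]; rewrite /cexp/= expRD cosD sinD rmorphM/= mulrACA.
by congr (_ * _); apply/eqP; rewrite eq_complex/= eqxx/= addrC.
Qed.

Lemma norm_cexp {R : realType} (z : Cpx R) :
  `|cexp z| = (expR (complex.Re z))%:C%C.
Proof.
rewrite normrM !normc_def/= cos2Dsin2 sqrtr1 mulr1 expr0n addr0.
by rewrite sqrtr_sqr ger0_norm ?expR_ge0.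
Qed.

Lemma zetaE {R : realType} (n : nat) (b : int) :
  zeta R n b = (cos (2 * pi * b%:~R / n%:R) +i* sin (2 * pi * b%:~R / n%:R))%C.
Proof.
set t := 2 * pi * b%:~R / n%:R; rewrite /zeta /cexp.
have -> : 2 * pi%:C%C * 'i * b%:~R / n%:R = (0 +i* t)%C :> Cpx R.
  rewrite [RHS]complexE/= add0r -complexiE /t !rmorphM fmorphV/=.
  rewrite !rmorph_nat rmorph_int. ring.
by rewrite /= expR0 mul1r.
Qed.

Lemma zetaD {R : realType} (n : nat) (b c : int) :
  zeta R n (b + c) = zeta R n b * zeta R n c.
Proof. by rewrite /zeta intrD mulrDr mulrDl cexpD. Qed.

Lemma norm_zeta {R : realType} (n : nat) (b : int) : `|zeta R n b| = 1.
Proof. by rewrite zetaE normc_def/= cos2Dsin2 sqrtr1. Qed.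

Lemma zeta0 {R : realType} (n : nat) : zeta R n 0 = 1.
Proof. by rewrite zetaE mulr0 mul0r cos0 sin0. Qed.

Lemma zetaX {R : realType} (n : nat) (b : int) (m : nat) :
  zeta R n b ^+ m = zeta R n (m%:Z * b).
Proof.
elim: m => [|m IHm]; first by rewrite mul0r zeta0.
by rewrite exprS IHm -zetaD -add1n PoszD mulrDl mul1r.
Qed.

Lemma zetaMl {R : realType} (d n : nat) (b : int) : (0 < d)%N ->
  zeta R (d * n) (d%:Z * b) = zeta R n b.
Proof.
move=> d0; rewrite !zetaE.
suff -> : 2 * pi * (d%:Z * b)%:~R / (d * n)%:R = 2 * pi * b%:~R / n%:R :> R by [].
have d0' : d%:R != 0 :> R by rewrite pnatr_eq0 -lt0n.
rewrite rmorphM natrM invfM/= -[d%:~R]/(d%:R : R).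
by set v := n%:R^-1; field.
Qed.

Lemma zeta_eq1 {R : realType} (n : nat) (b : int) : (0 < n)%N ->
  (zeta R n b == 1) = (n%:Z %| b)%Z.
Proof.
move=> n0; have n0' : n%:R != 0 :> R by rewrite pnatr_eq0 -lt0n.
have zn : zeta R n n = 1.
  by rewrite zetaE -[n%:~R]/(n%:R : R) mulfK// mulrC mulr_natr cos2pi sin2pi.
have zn' (u : int) : zeta R n (u * n%:Z) = 1.
  have zpos (m : nat) : zeta R n (m%:Z * n%:Z) = 1 by rewrite -zetaX zn expr1n.
  case: u => [m|m] //; rewrite NegzE.
  rewrite -[LHS]mulr1 -[in LHS](zpos m.+1) -zetaD mulNr addNr; exact: zeta0.
(* Only the remainder c of b modulo n matters from here on. *)
rewrite {1}(divz_eq b n) zetaD zn' mul1r.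
have [/dvdz_mod0P ->|nb] := boolP (n%:Z %| b)%Z; first by rewrite zeta0 eqxx.
set c := (b %% n)%Z; have c0 : 0 < c.
  rewrite lt_def modz_ge0 ?andbT; last by lia.
  by apply: contraNneq nb => /dvdz_mod0P.
have cn : c < n by rewrite ltz_pmod.
(* Half the angle lies strictly between 0 and pi, so sin s > 0 and cos 2s = 1 - 2 sin^2 s < 1. *)
pose s : R := pi * c%:~R / n%:R.
have sE : 2 * pi * c%:~R / n%:R = s *+ 2 by rewrite -[RHS]mulr_natl /s !mulrA.
have s0 : 0 < s < pi.
  rewrite /s divr_gt0 ?mulr_gt0 ?pi_gt0 ?ltr0z ?ltr0n//= -mulrA gtr_pMr ?pi_gt0//.
  by rewrite ltr_pdivrMr ?ltr0n// mul1r -[n%:R]/(n%:~R) ltr_int.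
apply: negbTE; rewrite zetaE sE eq_complex/= negb_and; apply/orP; left.
have := sin_gt0_pi s0; have := cos2Dsin2 s; rewrite cos_mulr2n => cs sp.
by rewrite lt_eqF// -cs mulr2n; have := exprn_gt0 2 sp; lra.
Qed.

(** A geometric sum: multiplied by its ratio minus 1, it gives the n-th power of the ratio minus 1,
    which is 0. *)
Lemma sum_zeta {R : realType} (n : nat) (b : int) : (0 < n)%N ->
  \sum_(0 <= j < n) zeta R n (j%:Z * b) = (if (n%:Z %| b)%Z then n%:R else 0).
Proof.
move=> n0; under eq_bigr => j _ do rewrite -zetaX.
rewrite big_mkord; case: ifPn => [|nb].
  rewrite -(zeta_eq1 (R := R))// => /eqP ->.
  by under eq_bigr => j _ do rewrite expr1n; rewrite sumr_const card_ord.
have z1 : zeta R n b - 1 != 0 by rewrite subr_eq0 zeta_eq1.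
by apply: (mulfI z1); rewrite -subrX1 mulr0 zetaX; apply/eqP;
   rewrite subr_eq0 zeta_eq1// dvdz_mulr.
Qed.

(** * Absolute convergence of the generating function *)

Lemma sum_pf_parts_bounded {R : realType} {f : {poly rat}} {r : R} :
  admissible f -> 0 <= r -> r < 1 ->
  exists B : R, forall J : {fset nat * nat},
    \sum_(mn <- J) (pf_parts f mn.1 mn.2)%:R * r ^+ mn.2 <= B.
Proof.
move=> hf r0 r1; have r10 : 0 < 1 - r by rewrite subr_gt0.
(* With x_l = r ^ f(l) <= r one has 1 / (1 - x_l) <= exp(x_l / (1 - r)), and the x_l sum to at most
   [size f] / (1 - r). *)
exists (expR ((size f)%:R / (1 - r) / (1 - r))) => J.
pose N := (\max_(mn <- J) mn.2)%N; have [L /(_ _ _)/= pfE] := pf_count hf N.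
set E := bounded_lists L N in pfE; pose x l : R := r ^+ part_size f l.
apply: (@le_trans _ _ (\sum_(s <- E) r ^+ weight (part_size f) s)).
  (* Each list is counted under the single pair of its length and weight, hence at most once in
     J. *)
  rewrite (eq_big_seq (fun mn => \sum_(s <- E)
      if (size s, weight (part_size f) s) == mn then r ^+ weight (part_size f) s else 0)).
    rewrite exchange_big/=; apply: ler_sum => s _.
    have [sJ|sJ] := boolP ((size s, weight (part_size f) s) \in J).
      rewrite (bigD1_seq _ sJ) ?fset_uniq//= eqxx big1 ?addr0// => mn.
      by rewrite eq_sym => /negbTE ->.
    rewrite big1_seq ?exprn_ge0// => mn /andP[_ mnJ]; case: eqP => // smn.
    by rewrite smn mnJ in sJ.
  move=> [m n] mnJ /=; rewrite (pfE n _).2; last first.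
    exact: (@leq_bigmax_seq _ _ xpredT (fun mn : nat * nat => mn.2) (m, n)).
  rewrite -sum1_count natr_sum mulr_suml -big_mkcond/=.
  by apply: eq_big => [s|s /andP[_ /eqP ->]]; rewrite ?mul1r// xpair_eqE.
have x0 l : 0 <= x l by exact: exprn_ge0.
have xr l : (0 < l)%N -> x l <= r.
  move=> /(part_size_gt0 hf); rewrite /x; case: (part_size f l) => // n _.
  by rewrite exprS ler_piMr// exprn_ile1// ltW.
set h := \sum_(s <- E) _; set e := expR (\sum_(1 <= l < L.+1) x l / (1 - r)).
have h0 : 0 <= h by apply: sumr_ge0 => s _; rewrite exprn_ge0.
(* Factor by factor: (1 - x)(1 + x / (1 - r)) - 1 = x (r - x) / (1 - r) is nonnegative for 0 <= x <=
   r. *)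
have Pe : 1 <= \prod_(1 <= l < L.+1) (1 - x l) * e.
  rewrite /e expR_sum -big_split/= big_nat; elim/big_ind: _ => //.
    by move=> y z y1 z1; rewrite -[1]mulr1 ler_pM.
  move=> l /andP[l0 _]; apply: le_trans (ler_wpM2l _ (expR_ge1Dx _)); last first.
    by rewrite subr_ge0 (le_trans (xr l l0))// ltW.
  rewrite -subr_ge0 (_ : _ - 1 = x l * (r - x l) / (1 - r)).
    by rewrite divr_ge0 ?mulr_ge0 ?subr_ge0 ?xr// ltW.
  by field; rewrite gt_eqF.
apply: (@le_trans _ _ e).
  apply: le_trans (ler_peMr h0 Pe) _; rewrite mulrA ler_piMl ?expR_ge0//.
  exact: sum_bounded_lists_le.
rewrite ler_expR -mulr_suml ler_pM2r ?invr_gt0// ler_pdivlMr//.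
exact: sum_fibers_le (part_size_fibers_le hf).
Qed.

(** As |x| = 1, the moduli of the terms are those of the real family at r = |q|. *)
Lemma cvg_Gf {R : realType} {f : {poly rat}} {x q : Cpx R} :
  admissible f -> `|x| = 1 -> `|q| < 1 ->
  (fun N => \sum_(0 <= n < N) \sum_(0 <= m < N)
     (pf_parts f m n)%:R * x ^+ m * q ^+ n) @ \oo --> Gf f x q.
Proof.
move=> hf x1 q1; pose r := complex.Re `|q|.
have qr : `|q| = r%:C%C := normCE q.
have r0 : 0 <= r by rewrite -ler0c -qr.
have r1 : r < 1 by rewrite -ltcR -qr.
have [B HB] := sum_pf_parts_bounded hf r0 r1.
apply: (@cvg_sum_boxes _ _ B) => J; apply: le_trans (HB J).
rewrite le_eqVlt; apply/orP; left; apply/eqP; apply: eq_bigr => mn _.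
apply: complexI; rewrite -normCE !normrM !normrX x1 expr1n mulr1 qr normr_nat.
by rewrite rmorphM rmorphXn rmorph_nat.
Qed.

(** * Selection of residue classes by roots of unity *)

(** Here n = m f(0) modulo d, and f(0) can be cancelled because it is prime to d. *)
Lemma dvdz_parts {f : {poly rat}} {a d m n : nat} :
  admissible f -> (0 < d)%N -> (d %| Pi f)%N -> pf_parts f m n != 0%N ->
  (n%:Z == a%:Z * polyZ f 0 %[mod d%:Z])%Z = (d%:Z %| m%:Z - a%:Z)%Z.
Proof.
move=> hf d0 hd /(partition_mod hf hd) /eqP ->.
rewrite eqz_mod_dvd -mulrBl Gauss_dvdzl//; exact: coprimez_polyZ0.
Qed.

(** For each m that occurs, m - a = d u, and the full sum over j is k or 0 according to whether k
    divides u, that is, dk divides m - a. The missing term j = 0 is 1 and accounts for p_f(n). *)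
Lemma sum_zeta_parts {R : realType} {f : {poly rat}} {a k d n N : nat} :
  admissible f -> (0 < k)%N -> (0 < d)%N -> (d %| Pi f)%N -> (n < N)%N ->
  (n%:Z == a%:Z * polyZ f 0 %[mod d%:Z])%Z ->
  \sum_(0 <= m < N) (pf_parts f m n)%:R *
    \sum_(1 <= j < k) zeta R (d * k) (j%:Z * (m%:Z - a%:Z)) =
  k%:R * ((pf_mod f a (d * k) n)%:R - (pf f n)%:R / k%:R) :> Cpx R.
Proof.
move=> hf k0 d0 hd nN na; have kC : k%:R != 0 :> Cpx R by rewrite pnatr_eq0 -lt0n.
rewrite (pf_mod_sum hf _ _ N n nN) (pf_sum hf N n nN) !natr_sum.
rewrite mulrBr mulrCA divff// mulr1 mulr_sumr [X in X - _]big_mkcond -sumrB/=.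
apply: eq_bigr => m _.
have [->|pmn] := eqVneq (pf_parts f m n) 0%N.
  by rewrite mul0r mulr0 if_same subr0.
move: na; rewrite (dvdz_parts hf d0 hd pmn) => /dvdzP[u ma].
have sE : \sum_(1 <= j < k) zeta R (d * k) (j%:Z * (m%:Z - a%:Z)) =
    (if (k%:Z %| u)%Z then k%:R else 0) - 1.
  rewrite ma -sum_zeta// [in RHS]big_ltn// mul0r zeta0 addrC addrA addNr add0r.
  by apply: eq_bigr => j _; rewrite mulrA [_ * d%:Z]mulrC zetaMl.
rewrite sE eqz_mod_dvd ma PoszM [u * _]mulrC dvdz_mul2l -?lt0n//.
by case: ifP => _; rewrite mulrBr mulr1 ?mulr0// mulrC.
Qed.

(** The exponents are regrouped so that j meets only m and l only n; the sums over j and l can then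
    be carried out separately. *)
Lemma twist_Gf {R : realType} {f : {poly rat}} (a k d j l N : nat) (q : Cpx R) :
  (0 < k)%N ->
  zeta R (d * k) (- (j%:Z * a%:Z) - k%:Z * l%:Z * a%:Z * polyZ f 0) *
    \sum_(0 <= n < N) \sum_(0 <= m < N) (pf_parts f m n)%:R *
      zeta R (d * k) j ^+ m * (zeta R d l * q) ^+ n =
  \sum_(0 <= n < N)
    (\sum_(0 <= m < N) (pf_parts f m n)%:R *
      zeta R (d * k) (j%:Z * (m%:Z - a%:Z))) *
    (zeta R d (l%:Z * (n%:Z - a%:Z * polyZ f 0)) * q ^+ n).
Proof.
move=> k0; rewrite mulr_sumr; apply: eq_bigr => n _.
rewrite mulr_sumr mulr_suml; apply: eq_bigr => m _.
have -> : k%:Z * l%:Z * a%:Z * polyZ f 0 = k%:Z * (l%:Z * (a%:Z * polyZ f 0)).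
  by rewrite !mulrA.
rewrite -[- (k%:Z * _)]mulrN zetaD (mulnC d k) zetaMl//.
rewrite (exprMn _ (zeta R d l) q) !zetaX.
rewrite !mulrBr !zetaD [j%:Z * m%:Z]mulrC [l%:Z * n%:Z]mulrC; ring.
Qed.

Theorem proposition1p1 (R : realType) (f : {poly rat}) (hf : admissible f)
    (a k d : nat) (ha : (0 < a)%N) (hk : (0 < k)%N) (hd : (0 < d)%N)
    (hdPi : (d %| Pi f)%N) :
  [/\ forall n : nat, ~~ (d%:Z %| n%:Z - a%:Z * polyZ f 0)%Z ->
        pf_mod f a (d * k) n = 0%N,
      forall z : Cpx R, 0 < complex.Re z ->
        let q : Cpx R := cexp (- z) in
        (fun N : nat =>
           \sum_(0 <= n < N | (n%:Z == a%:Z * polyZ f 0 %[mod d%:Z])%Z)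
             ((pf_mod f a (d * k) n)%:R - (pf f n)%:R / k%:R) * q ^+ n : Cpx R)
          @ \oo -->
        (1 / (k%:R * d%:R) *
         \sum_(1 <= j < k) \sum_(0 <= l < d)
           zeta R (d * k) (- (j%:Z * a%:Z) - k%:Z * l%:Z * a%:Z * polyZ f 0) *
           Gf f (zeta R (d * k) j) (zeta R d l * q) : Cpx R)
    & forall n : nat, (d%:Z %| n%:Z - a%:Z * polyZ f 0)%Z ->
        pf_mod f a d n = pf f n].
Proof.
have kC : k%:R != 0 :> Cpx R by rewrite pnatr_eq0 -lt0n.
have dC : d%:R != 0 :> Cpx R by rewrite pnatr_eq0 -lt0n.
split=> [n dn|z z0 q|n dn].
(* A partition with m = a modulo dk parts would have m = a modulo d, forcing n = a f(0) modulo d. *)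
- rewrite (pf_mod_sum hf _ _ n.+1)// big1// => m ma; apply: contraNeq dn => pmn.
  rewrite -eqz_mod_dvd (dvdz_parts hf hd hdPi pmn); move: ma; rewrite eqz_mod_dvd.
  by apply: dvdz_trans; rewrite PoszM dvdz_mulr.
- have q1 : `|q| < 1.
    by rewrite norm_cexp ltcR raddfN/= -expR0 ltr_expR oppr_lt0.
  pose t := a%:Z * polyZ f 0.
  pose G j l N : Cpx R := \sum_(0 <= n < N) \sum_(0 <= m < N)
    (pf_parts f m n)%:R * zeta R (d * k) j ^+ m * (zeta R d l * q) ^+ n.
  pose S N : Cpx R := 1 / (k%:R * d%:R) *
    \sum_(1 <= j < k) \sum_(0 <= l < d)
      zeta R (d * k) (- (j%:Z * a%:Z) - k%:Z * l%:Z * a%:Z * polyZ f 0) * G j l N.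
  (* The identity is exact at every truncation N; only the right side then needs a limit, taken term
     by term. *)
  rewrite (_ : (fun N => _) = S); last first.
    apply/funext => N; rewrite /S.
    under [in RHS]eq_bigr => j _ do under eq_bigr => l _ do rewrite twist_Gf//.
    under [in RHS]eq_bigr => j _ do rewrite exchange_big.
    rewrite exchange_big/= mulr_sumr big_mkcond big_nat [RHS]big_nat/=.
    apply: eq_bigr => n /= nN.
    under [in RHS]eq_bigr => j _ do rewrite -mulr_sumr -mulr_suml.
    (* The sum over l is d when n = a f(0) modulo d, and 0 otherwise. *)
    rewrite -mulr_suml exchange_big/= sum_zeta// -eqz_mod_dvd.
    under [in RHS]eq_bigr => m _ do rewrite -mulr_sumr.
    case: ifP => na; last by rewrite mul0r !mulr0.
    by rewrite sum_zeta_parts//; field; rewrite kC dC.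
  apply: cvgM; first exact: cvg_cst.
  apply: cvg_big => [|j _]; first exact: add_continuous.
  apply: cvg_big => [|l _]; first exact: add_continuous.
  apply: cvgM; first exact: cvg_cst.
  by apply: cvg_Gf => //; rewrite ?norm_zeta// normrM norm_zeta mul1r.
(* The terms left out by the congruence condition on m vanish, since only m = a modulo d occur. *)
- rewrite (pf_mod_sum hf _ _ n.+1)// (pf_sum hf n.+1)// big_mkcond/=.
  apply: eq_bigr => m _; case: ifPn => // ma.
  apply/esym/eqP; apply: contraNT ma => pmn.
  by rewrite eqz_mod_dvd -(dvdz_parts hf hd hdPi pmn) eqz_mod_dvd.
Qed.
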